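(* Let $0<m<M$, let $n\ge1$ and $H\ge0$ be integers with $H\le n/4$. For every price sequence with prices in $[m,M]$ and best price $p^*$, and every way of answering the $n$ comparison queries of RBIS (described in the context) with at most $H$ incorrect answers, the price accepted by RBIS is at least $p^*\cdot (M/m)^{-2^{2H-n/2}}$; that is, RBIS has competitive ratio at most $(M/m)^{2^{2H-n/2}}$.
   Context: Online search problem: a sequence of prices $\sigma_1,\dots,\sigma_d\in[m,M]$ ($d\ge1$ unknown to the player) is revealed one per day; each revealed price is irrevocably accepted (profit equals that price, game ends) or rejected; if the first $d-1$ prices are rejected the last is accepted by default. $p^*=\max_i\sigma_i$. Before the prices are revealed, the algorithm may ask $n$ queries about $p^*$ answered by an oracle, of which at most $H$ answers are incorrect ($H$ known to the algorithm). Let $\rho=(M/m)^{1/2^n}$, $a_i=m\rho^i$ for $i=0,\dots,2^n$, and $L_i=(a_{i-1},a_i]$ for $i=1,\dots,2^n$; let $x$ be the index with $p^*\in L_x$ ($x=1$ if $p^*=m$). Let $T$ be a complete binary tree of height $n$ whose leaves from left to right are $L_1,\dots,L_{2^n}$; for an internal node $v$, $l(v),r(v)$ are its children and $q_v$ is the index of the rightmost leaf of the subtree rooted at $l(v)$. The main query of $v$ is ''Is $p^*\le a_{q_v}$?''. Algorithm RBIS (Robust Binary Interval Search): start with current node $v$ the root and counter $mu=0$, and repeat the following iteration: ask the main query of $v$ and store the answer as $\mathtt{main}(v)$ (overwriting earlier stored answers for $v$); let $anc(v)$ be the nearest proper ancestor $w$ of $v$ whose currently stored $\mathtt{main}(w)$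 differs from $\mathtt{main}(v)$, or none; if $anc(v)$ exists, ask again the main query of $anc(v)$ (the checkup query), with answer $\mathtt{check}(v)$. If $anc(v)$ does not exist or $\mathtt{check}(v)=\mathtt{main}(anc(v))$, Move-down: move to $l(v)$ if $\mathtt{main}(v)$ is Yes, to $r(v)$ if No; otherwise Move-up: move to the parent of $v$ and increase $mu$ by one. The search stops as soon as $n$ queries have been asked (an iteration that cannot ask its needed queries performs no move). With $u$ the final node and $mu_{end}$ the final counter value, let $a_u$ be the $(H-mu_{end})$-th ancestor of $u$ (or the root if it does not exist) and $L_l$ the leftmost leaf of the subtree rooted at $a_u$. RBIS then accepts the first revealed price that is at least $a_{l-1}$ (the last price by default). *)

(* Defs.v *)
From HB Require Import structures.
From mathcomp Require Import all_boot all_order all_algebra.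
From mathcomp Require Import all_classical all_reals all_analysis.

Set Implicit Arguments.
Unset Strict Implicit.
Unset Printing Implicit Defensive.

Import Order.TTheory GRing.Theory Num.Theory.

Local Open Scope ring_scope.

(* A node is a pair (depth, position from the left within its level, starting
   at 0). In the tree of height n the leaves are the nodes of depth n, and the
   leaf at position j carries the interval L_(j+1). *)
Definition node : Type := (nat * nat)%type.

Definition depth (v : node) : nat := v.1.
Definition position (v : node) : nat := v.2.

Definition root_node : node := (0, 0)%N.
Definition lchild (v : node) : node := ((depth v).+1, (position v).*2).
Definition rchild (v : node) : node := ((depth v).+1, (position v).*2.+1).

(* The parent of the root is the root itself, so that [ancestor k v] is the
   root when v has no k-th ancestor. *)
Definition parent (v : node) : node := ((depth v).-1, (position v)./2).
Definition ancestor (k : nat) (v : node) : node := iter k parent v.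

(* Listed from the nearest one up to the root. *)
Definition proper_ancestors (v : node) : seq node :=
  [seq ancestor k v | k <- iota 1 (depth v)].

Definition leftmost_leaf (n : nat) (v : node) : node :=
  iter (n - depth v) lchild v.
Definition rightmost_leaf (n : nat) (v : node) : node :=
  iter (n - depth v) rchild v.

(* The index i of the leaf L_i, counted from 1. *)
Definition leaf_index (v : node) : nat := (position v).+1.

(* q_v, the index of the rightmost leaf of the subtree rooted at l(v). *)
Definition query_index (n : nat) (v : node) : nat :=
  leaf_index (rightmost_leaf n (lchild v)).

(* [log] lists, in the order in which they were asked, the queries made so far
   with their answers: (v, b) stands for the main query of v answered by b,
   where true is Yes. A checkup query is logged under the ancestor whose main
   query is asked again. *)
Record state := State {
  current : node;
  mu : nat;
  main : node -> option bool;
  log : seq (node * bool)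
}.

Definition initial_state : state :=
  State root_node 0 (fun=> None) [::].

Definition asked (st : state) : nat := size (log st).

Definition store (f : node -> option bool) (v : node) (b : bool) :
    node -> option bool :=
  fun w => if w == v then Some b else f w.

Definition anc (f : node -> option bool) (v : node) (b : bool) : option node :=
  ohead [seq w <- proper_ancestors v | if f w is Some b' then b' != b else false].

Definition move_down (b : bool) (st : state) : state :=
  State (if b then lchild (current st) else rchild (current st))
        (mu st) (main st) (log st).

Definition move_up (st : state) : state :=
  State (parent (current st)) (mu st).+1 (main st) (log st).

(* [ans k] is the answer given to the k-th query asked, counted from 0. Since
   RBIS is deterministic, letting [ans] range over all Boolean sequences covers
   every answering strategy, adaptive ones included. *)
Definition ask_main (ans : nat -> bool) (st : state) : state :=
  let v := current st in let b := ans (asked st) in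
  State v (mu st) (store (main st) v b) (rcons (log st) (v, b)).

Definition ask_checkup (ans : nat -> bool) (w : node) (st : state) : state :=
  State (current st) (mu st) (main st) (rcons (log st) (w, ans (asked st))).

Definition iteration (n : nat) (ans : nat -> bool) (st : state) : state :=
  if (asked st < n)%N then
    let b := ans (asked st) in
    let st1 := ask_main ans st in
    if anc (main st1) (current st1) b is Some w then
      if (asked st1 < n)%N then
        let c := ans (asked st1) in
        let st2 := ask_checkup ans w st1 in
        if main st2 w == Some c then move_down b st2 else move_up st2
      else st1
    else move_down b st1
  else st.

(* An iteration asks at least one query as long as fewer than n have been
   asked, and does nothing afterwards, so that n iterations are enough. *)
Definition search (n : nat) (ans : nat -> bool) : state :=
  iter n (iteration n ans) initial_state.

(* The subtraction H - mu_end is truncated, but mu_end never exceeds H when at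
   most H answers are incorrect. *)
Definition reservation_index (n H : nat) (ans : nat -> bool) : nat :=
  let st := search n ans in
  leaf_index (leftmost_leaf n (ancestor (H - mu st) (current st))).

Definition rho (R : realType) (m M : R) (n : nat) : R :=
  (M / m) `^ ((2 ^+ n)^-1).

(* The end points a_i of the intervals L_i = (a_(i-1), a_i]. *)
Definition endpoint (R : realType) (m M : R) (n i : nat) : R :=
  m * rho m M n ^+ i.

Definition best_price (R : realType) (sigma : seq R) : R :=
  \big[Num.max/head 0 sigma]_(p <- sigma) p.

(* [find] returns [size sigma] when no price reaches t, in which case [nth]
   falls back on its default, the last price. *)
Definition first_at_least (R : realType) (t : R) (sigma : seq R) : R :=
  nth (last 0 sigma) sigma (find (fun p => t <= p) sigma).

Definition num_incorrect (R : realType) (m M : R) (n : nat) (pstar : R)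
    (ans : nat -> bool) : nat :=
  count (fun qb : node * bool =>
           qb.2 != (pstar <= endpoint m M n (query_index n qb.1)))
        (log (search n ans)).

Definition rbis_price (R : realType) (m M : R) (n H : nat)
    (ans : nat -> bool) (sigma : seq R) : R :=
  first_at_least (endpoint m M n (reservation_index n H ans).-1) sigma.

(* Main.v *)
(* Let X be the leaf of p*. Call the distance from the current node up to its
   nearest ancestor above X the error of the search. Error plus number of
   move-ups never exceeds the number of wrong answers so far: if both answers of
   an iteration are correct, then the search either descends towards X (when the
   current node is above X) or retreats towards X (when it is not, because then
   the ancestor queried again stored a wrong answer). Hence the
   (H - mu_end)-th ancestor of the final node is above X. An iteration makes one
   move for at most two queries, and the first one asks a single query, so this
   ancestor has depth at least n/2 - 2H; the end points of its interval have
   ratio at most (M/m)^(2^(2H - n/2)). *)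

Require Import Defs.
From HB Require Import structures.
From mathcomp Require Import all_boot all_order all_algebra.
From mathcomp Require Import all_classical all_reals all_analysis.
From mathcomp Require Import zify lra.

Import Order.TTheory GRing.Theory Num.Theory.

Local Open Scope ring_scope.

(** * Head of a filtered list *)

Lemma ohead_filter_Some (T : Type) (P : pred T) (s : seq T) (y : T) :
  ohead [seq x <- s | P x] = Some y ->
  exists i, [/\ (i < size s)%N, nth y s i = y, P y &
                forall j, (j < i)%N -> ~~ P (nth y s j)].
Proof.
elim: s => [//|x s IHs] /=; case: ifP => [Px [<-]|Px /IHs[i [lt_i nth_i Py before]]].
  by exists 0%N.
by exists i.+1; split=> // -[|j]; rewrite ?Px //= ltnS; apply: before.
Qed.

Lemma ohead_filter_None (T : Type) (P : pred T) (s : seq T) :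
  ohead [seq x <- s | P x] = None -> ~~ has P s.
Proof. by elim: s => [//|x s IHs] /=; case: ifP => //= _ /IHs. Qed.

(** * Tree geometry: ancestors, leaf ranges and their split by main queries *)

Section Tree.
Local Open Scope nat_scope.

Lemma ancestorS (k : nat) (v : node) : ancestor k.+1 v = parent (ancestor k v).
Proof. by []. Qed.

Lemma ancestorSr (k : nat) (v : node) : ancestor k.+1 v = ancestor k (parent v).
Proof. by rewrite /ancestor iterSr. Qed.

Lemma depth_ancestor (k : nat) (v : node) : depth (ancestor k v) = depth v - k.
Proof.
elim: k => [|k IHk]; first by rewrite subn0.
by rewrite ancestorS /depth /= -/(depth _) IHk subnS.
Qed.

Lemma parent_lchild (v : node) : parent (lchild v) = v.
Proof. by case: v => d p; rewrite /parent /lchild /= doubleK. Qed.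

Lemma parent_rchild (v : node) : parent (rchild v) = v.
Proof. by case: v => d p; rewrite /parent /rchild /= uphalf_double. Qed.

Lemma position_leftmost_leaf (n : nat) (v : node) :
  position (leftmost_leaf n v) = position v * 2 ^ (n - depth v).
Proof.
rewrite /leftmost_leaf; elim: (n - depth v) => [|k IHk] /=; first by rewrite muln1.
by rewrite /position /= -/(position _) IHk expnS -muln2 -mulnA [2 * _]mulnC.
Qed.

(* The leaves below [v] are those at positions [span_lo n v <= X < span_hi n v]. *)
Definition span_lo (n : nat) (v : node) : nat := position v * 2 ^ (n - depth v).
Definition span_hi (n : nat) (v : node) : nat := (position v).+1 * 2 ^ (n - depth v).
Definition below (n X : nat) (v : node) : bool := span_lo n v <= X < span_hi n v.

Lemma leaf_index_leftmost_leaf (n : nat) (v : node) :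
  leaf_index (leftmost_leaf n v) = (span_lo n v).+1.
Proof. by rewrite /leaf_index position_leftmost_leaf. Qed.

Lemma query_index_lchild (n : nat) (v : node) : query_index n v = span_hi n (lchild v).
Proof.
rewrite /query_index /leaf_index /rightmost_leaf /span_hi; set w := lchild v.
elim: (n - depth w) => [|k IHk] /=; first by rewrite muln1.
by rewrite /position /= -/(position _) -/(position w) expnS mulnCA -IHk mul2n.
Qed.

Lemma query_index_rchild (n : nat) (v : node) : query_index n v = span_lo n (rchild v).
Proof. by rewrite query_index_lchild. Qed.

Lemma span_lo_lchild (n : nat) (v : node) :
  depth v < n -> span_lo n (lchild v) = span_lo n v.
Proof.
case: v => d p; rewrite /span_lo /depth /position /= => d_lt.
by rewrite -(subnSK d_lt) expnS; lia.
Qed.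

Lemma span_hi_rchild (n : nat) (v : node) :
  depth v < n -> span_hi n (rchild v) = span_hi n v.
Proof.
case: v => d p; rewrite /span_hi /depth /position /= => d_lt.
by rewrite -(subnSK d_lt) expnS; lia.
Qed.

Lemma query_index_span (n : nat) (v : node) :
  depth v < n -> span_lo n v < query_index n v < span_hi n v.
Proof.
move=> d_lt; rewrite {1}query_index_lchild query_index_rchild.
rewrite -(span_lo_lchild n v d_lt) -(span_hi_rchild n v d_lt).
rewrite /span_lo /span_hi /lchild /rchild /depth /position /=.
by rewrite !ltn_pmul2r ?expn_gt0 // !ltnS !leqnn.
Qed.

Lemma even_child (v : node) :
  0 < depth v -> ~~ odd (position v) -> v = lchild (parent v).
Proof. by case: v => -[|d] p //= _ p_even; rewrite /lchild /= even_halfK. Qed.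

Lemma odd_child (v : node) :
  0 < depth v -> odd (position v) -> v = rchild (parent v).
Proof.
case: v => -[|d] p //= _ p_odd; rewrite /rchild /= odd_halfK //.
by congr pair; case: p p_odd.
Qed.

(** Excludes pairs that are not nodes of the infinite binary tree; the height bound [depth v <= n]
    is stated separately. *)
Definition valid_node (v : node) : bool := position v < 2 ^ depth v.

Lemma valid_parent (v : node) : valid_node v -> valid_node (parent v).
Proof.
case: v => -[|d] p; rewrite /valid_node /depth /position /=.
  by rewrite expn0 ltnS leqn0 => /eqP->.
by rewrite expnS; have := odd_double_half p; lia.
Qed.

Lemma valid_ancestor (k : nat) (v : node) : valid_node v -> valid_node (ancestor k v).
Proof. by move=> v_valid; elim: k => // k; apply: valid_parent. Qed.

Lemma valid_lchild (v : node) : valid_node v -> valid_node (lchild v).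
Proof. by rewrite /valid_node {2}/depth {2}/position /= expnS mul2n ltn_double. Qed.

Lemma valid_rchild (v : node) : valid_node v -> valid_node (rchild v).
Proof. by rewrite /valid_node {2}/depth {2}/position /= expnS mul2n ltn_Sdouble. Qed.

Lemma ancestor_depth (v : node) : valid_node v -> ancestor (depth v) v = root_node.
Proof.
move=> /(valid_ancestor (depth v)); have := depth_ancestor (depth v) v.
rewrite subnn; case: (ancestor _ v) => d p; rewrite /valid_node /depth /= => ->.
by rewrite /position /= expn0 ltnS leqn0 => /eqP->.
Qed.

Lemma below_parent (n X : nat) (v : node) :
  valid_node v -> depth v <= n -> below n X v -> below n X (parent v).
Proof.
case: v => -[|d] p v_valid d_le.
  by move: v_valid; rewrite /valid_node /depth /position /= expn0 ltnS leqn0 => /eqP->.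
have pd: depth (parent (d.+1, p)) < n by [].
have qs := query_index_span n _ pd.
have d_gt0 : 0 < depth (d.+1, p) by [].
have [/(odd_child _ d_gt0)|/(even_child _ d_gt0)] := boolP (odd (position (d.+1, p))).
  move=> E; rewrite {1}E /below -query_index_rchild span_hi_rchild //; lia.
move=> E; rewrite {1}E /below -query_index_lchild span_lo_lchild //; lia.
Qed.

Lemma below_ancestor (n X i j : nat) (v : node) :
  valid_node v -> depth v <= n -> i <= j ->
  below n X (ancestor i v) -> below n X (ancestor j v).
Proof.
move=> v_valid d_le; elim: j => [|j IHj]; first by rewrite leqn0 => /eqP->.
rewrite leq_eqVlt => /orP[/eqP->//|/IHj{}IHj /IHj]; apply: below_parent.
  exact: valid_ancestor.
by rewrite depth_ancestor; lia.
Qed.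

(** A left child shares its left end with its parent, so climbing through left children only never
    moves that end. [span_hi_odd] is the mirror image. *)
Lemma span_lo_even (n k : nat) (v : node) :
  depth v <= n -> k <= depth v ->
  (forall i, i < k -> ~~ odd (position (ancestor i v))) ->
  span_lo n (ancestor k v) = span_lo n v.
Proof.
move=> d_le; elim: k => [//|k IHk] k_lt even_before.
rewrite -IHk; [|lia|by move=> i ik; apply: even_before; lia].
have /even_child->// := even_before k (ltnSn k); last by rewrite depth_ancestor; lia.
by rewrite span_lo_lchild ?ancestorS // -ancestorS depth_ancestor; lia.
Qed.

Lemma span_hi_odd (n k : nat) (v : node) :
  depth v <= n -> k <= depth v ->
  (forall i, i < k -> odd (position (ancestor i v))) ->
  span_hi n (ancestor k v) = span_hi n v.
Proof.
move=> d_le; elim: k => [//|k IHk] k_lt odd_before.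
rewrite -IHk; [|lia|by move=> i ik; apply: odd_before; lia].
have /odd_child->// := odd_before k (ltnSn k); last by rewrite depth_ancestor; lia.
by rewrite span_hi_rchild ?ancestorS // -ancestorS depth_ancestor; lia.
Qed.

(** * Answers stored along the path, and the ancestor that a checkup queries *)

Lemma query_index_parent (n : nat) (v : node) :
  0 < depth v ->
  query_index n (parent v) = if odd (position v) then span_lo n v else span_hi n v.
Proof.
move=> d_gt0; case: ifPn => [/odd_child|/even_child] /(_ d_gt0) E.
  by rewrite {2}E query_index_rchild.
by rewrite {2}E query_index_lchild.
Qed.

(* The answers stored along the path to [v] are those that led the search to [v]. *)
Definition directed (f : node -> option bool) (v : node) : Prop :=
  forall k, k < depth v ->
    f (ancestor k.+1 v) = Some (~~ odd (position (ancestor k v))).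

Lemma size_proper_ancestors (v : node) : size (proper_ancestors v) = depth v.
Proof. by rewrite size_map size_iota. Qed.

Lemma nth_proper_ancestors (w v : node) (k : nat) :
  k < depth v -> nth w (proper_ancestors v) k = ancestor k.+1 v.
Proof. by move=> k_lt; rewrite (nth_map 0) ?size_iota // nth_iota. Qed.

(** Since [w] is the nearest disagreeing ancestor, the path turns against [b] at [w] and follows [b]
    from there on. Hence [v] is the extreme node of its level, on side [b], below [ancestor k v]. *)
Lemma anc_Some (f : node -> option bool) (v w : node) (b : bool) :
  directed f v -> anc f v b = Some w ->
  exists k, [/\ k < depth v, w = ancestor k.+1 v, f w = Some (~~ b),
                odd (position (ancestor k v)) = b &
                forall i, i < k -> odd (position (ancestor i v)) = ~~ b].
Proof.
move=> f_dir /(ohead_filter_Some _ _ _ _)[k []].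
rewrite size_proper_ancestors => k_lt; rewrite nth_proper_ancestors // => <-.
rewrite f_dir // => odd_k before; exists k; split=> //.
- by move: odd_k; case: (odd _); case: (b).
- by move: odd_k; case: (odd _); case: (b).
move=> i ik; have := before i ik.
rewrite nth_proper_ancestors ?(ltn_trans ik) // f_dir ?(ltn_trans ik) //.
by case: (odd _); case: (b).
Qed.

Lemma anc_None (f : node -> option bool) (v : node) (b : bool) :
  directed f v -> anc f v b = None ->
  forall i, i < depth v -> odd (position (ancestor i v)) = ~~ b.
Proof.
move=> f_dir /(ohead_filter_None _ _ _)/hasPn none i i_lt.
have /none : ancestor i.+1 v \in proper_ancestors v.
  by rewrite -(nth_proper_ancestors v) // mem_nth ?size_proper_ancestors.
by rewrite f_dir //; case: (odd _); case: (b).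
Qed.

(** The correct answer when the best price lies in the leaf at position [X], that is in L_(X+1): X +
    1 <= q becomes a strict inequality. *)
Definition truth (n X : nat) (v : node) : bool := X < query_index n v.

(** The separator of an ancestor is an end of the range of its child on the path, and that range
    contains [X]. So a correct checkup never refutes an answer stored above a node that is above
    [X]. *)
Lemma stored_truth (n X k : nat) (f : node -> option bool) (v : node) :
  valid_node v -> depth v <= n -> directed f v -> below n X v -> k < depth v ->
  f (ancestor k.+1 v) = Some (truth n X (ancestor k.+1 v)).
Proof.
move=> v_valid d_le f_dir v_below k_lt; rewrite f_dir //; congr Some.
rewrite /truth query_index_parent ?depth_ancestor ?subn_gt0 //.
have := below_ancestor n X 0 k v v_valid d_le (leq0n k) v_below.
by rewrite /below; case: (odd _) => /andP[lo hi] /=; [rewrite ltnNge lo | rewrite hi].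
Qed.

(** Without disagreement the path always follows the same answer, so the range of [v] reaches the
    edge of the whole tree on that side; a correct answer at [v] bounds [X] on the other side. *)
Lemma anc_None_below (n X : nat) (f : node -> option bool) (v : node) :
  valid_node v -> depth v < n -> X < 2 ^ n -> directed f v ->
  anc f v (truth n X v) = None -> below n X v.
Proof.
move=> v_valid d_lt X_lt f_dir /(anc_None _ _ _ f_dir) path.
have /andP[lo_lt hi_gt] := query_index_span n v d_lt.
move: path; rewrite /truth /below; case: (ltnP X (query_index n v)) => X_q path.
  rewrite -(span_lo_even n (depth v) v) ?ancestor_depth ?(ltnW d_lt) //.
    by rewrite /span_lo mul0n; lia.
  by move=> i /path->.
rewrite -(span_hi_odd n (depth v) v) ?ancestor_depth ?(ltnW d_lt) //.
by rewrite /span_hi mul1n subn0 X_lt andbT; lia.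
Qed.

(* If [v] misses [X], then [v] is the extreme node on the side of [X] in the
   subtree below [w] that contains it, so the stored answer at [w] is wrong. *)
Lemma anc_Some_below (n X : nat) (f : node -> option bool) (v w : node) :
  valid_node v -> depth v < n -> directed f v ->
  anc f v (truth n X v) = Some w -> f w = Some (truth n X w) -> below n X v.
Proof.
move=> v_valid d_lt f_dir /(anc_Some _ _ _ _ f_dir)[k [k_lt -> -> odd_k path]] [].
rewrite {2}/truth query_index_parent ?depth_ancestor ?subn_gt0 // odd_k.
have /andP[lo_lt hi_gt] := query_index_span n v d_lt.
move: odd_k path; rewrite /truth /below; case: (ltnP X (query_index n v)) => X_q odd_k path.
  rewrite span_lo_even ?(ltnW d_lt) ?(ltnW k_lt) //; first by lia.
  by move=> i /path->.
by rewrite span_hi_odd ?(ltnW d_lt) ?(ltnW k_lt) //; lia.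
Qed.

(** * Effect of moves on the range and on the stored path *)

Definition child (b : bool) (v : node) : node := if b then lchild v else rchild v.

Lemma parent_child (b : bool) (v : node) : parent (child b v) = v.
Proof. by case: b; rewrite /= ?parent_lchild ?parent_rchild. Qed.

Lemma depth_child (b : bool) (v : node) : depth (child b v) = (depth v).+1.
Proof. by case: b. Qed.

Lemma odd_position_child (b : bool) (v : node) : odd (position (child b v)) = ~~ b.
Proof. by case: b; rewrite /position /= odd_double. Qed.

Lemma valid_child (b : bool) (v : node) : valid_node v -> valid_node (child b v).
Proof. by case: b; [apply: valid_lchild | apply: valid_rchild]. Qed.

Lemma below_child (n X : nat) (v : node) :
  depth v < n -> below n X v -> below n X (child (truth n X v) v).
Proof.
move=> d_lt; rewrite /below /truth /child; case: (ltnP X (query_index n v)) => X_q /andP[lo hi] /=.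
  by rewrite span_lo_lchild // -query_index_lchild lo.
by rewrite span_hi_rchild // -query_index_rchild hi X_q.
Qed.

(** The new answer sits at [v] itself, and proper ancestors have smaller depth. *)
Lemma directed_store (f : node -> option bool) (v : node) (b : bool) :
  directed f v -> directed (store f v b) v.
Proof.
move=> f_dir k k_lt; rewrite /store; case: eqP => [/(congr1 depth)|_].
  by rewrite depth_ancestor; lia.
exact: f_dir.
Qed.

Lemma directed_child (f : node -> option bool) (v : node) (b : bool) :
  directed f v -> f v = Some b -> directed f (child b v).
Proof.
move=> f_dir fv [|k] k_lt.
  rewrite -[LHS]/(f (parent (child b v))) parent_child fv.
  by rewrite -[ancestor 0 _]/(child b v) odd_position_child negbK.
rewrite !(ancestorSr _ (child b v)) parent_child.
by apply: f_dir; rewrite depth_child in k_lt.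
Qed.

Lemma directed_parent (f : node -> option bool) (v : node) :
  directed f v -> directed f (parent v).
Proof.
move=> f_dir k k_lt; rewrite -!ancestorSr; apply: f_dir.
by move: k_lt; rewrite {1}/depth /= -/(depth v); lia.
Qed.

End Tree.

(** * The invariant of the search and the depth of the reservation node *)

Section Search.
Local Open Scope nat_scope.

Definition lies (n X : nat) (s : seq (node * bool)) : nat :=
  count (fun qb : node * bool => qb.2 != truth n X qb.1) s.

Lemma lies_rcons (n X : nat) (s : seq (node * bool)) (v : node) (b : bool) :
  lies n X (rcons s (v, b)) = lies n X s + (b != truth n X v).
Proof. by rewrite /lies -cats1 count_cat /= addn0. Qed.

(* [inv_below]: every move-up and every level by which the current node misses
   the leaf [X] is paid for by a distinct lie.  [inv_moves]: the number of
   completed iterations is depth + 2 mu, each uses at most two queries, and the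
   first one, at the root, uses a single query. *)
Record search_inv (n X : nat) (st : state) : Prop := SearchInv {
  inv_valid : valid_node (current st);
  inv_depth : depth (current st) <= asked st;
  inv_asked : asked st <= n;
  inv_directed : directed (main st) (current st);
  inv_mu : mu st <= lies n X (log st);
  inv_below : below n X (ancestor (lies n X (log st) - mu st) (current st));
  inv_moves : asked st + (0 < asked st < n) <= (depth (current st) + (mu st).*2).*2
}.

Lemma search_inv_initial (n X : nat) : X < 2 ^ n -> search_inv n X initial_state.
Proof. by move=> X_lt; split=> //; rewrite /below /span_lo /span_hi /= mul1n subn0. Qed.

(** Here [i] and [j] are lies minus move-ups before and after the iteration. A new lie pays for the
    extra level; if there is none, the move is towards [X]. *)
Lemma below_move_down (n X i j : nat) (b : bool) (v : node) :
  valid_node v -> depth v < n -> i <= j -> below n X (ancestor i v) ->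
  (i = j -> b = truth n X v /\ below n X v) ->
  below n X (ancestor j (child b v)).
Proof.
move=> v_valid d_lt ij v_below no_lie.
have [eq_ij|ne_ij] := eqVneq i j.
  have [-> v_below0] := no_lie eq_ij.
  apply: (below_ancestor n X 0); rewrite ?depth_child //; first exact: valid_child.
  exact: below_child.
have {ne_ij}ij : i < j by rewrite ltn_neqAle ne_ij.
rewrite -(subnKC ij) addSn ancestorSr parent_child.
by apply: below_ancestor v_below; rewrite ?(ltnW d_lt) ?leq_addr.
Qed.

(** With [i], [j] as in [below_move_down], the predecessor of [j] accounts for the increment of
    [mu]; it cancels against the step to the parent. If [j] were 0, there would be no new lie and
    [v] would be above [X]. *)
Lemma below_move_up (n X i j : nat) (v : node) :
  valid_node v -> depth v < n -> i <= j -> below n X (ancestor i v) ->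
  (i = j -> ~~ below n X v) ->
  0 < j /\ below n X (ancestor j.-1 (parent v)).
Proof.
move=> v_valid d_lt ij v_below no_lie.
have j_gt0 : 0 < j.
  case: j ij no_lie => // /eqP; rewrite subn0 => i0; rewrite i0 in v_below *.
  by move=> /(_ erefl)/negP/(_ v_below).
split=> //; rewrite -ancestorSr prednK //.
by apply: below_ancestor v_below; rewrite ?(ltnW d_lt).
Qed.

Lemma search_inv_iteration (n X : nat) (ans : nat -> bool) (st : state) :
  X < 2 ^ n -> search_inv n X st -> search_inv n X (iteration n ans st).
Proof.
move=> X_lt []; case: st => v u f s; rewrite /iteration /ask_main /asked /=.
move=> v_valid d_le s_le f_dir u_le v_below moves.
have [s_lt|//] := ltnP (size s) n.
set b := ans (size s); set f' := store f v b.
have f'_dir : directed f' v by apply: directed_store.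
have f'_v : f' v = Some b by rewrite /f' /store eqxx.
have d_lt : depth v < n by apply: leq_ltn_trans s_lt.
case E: (anc f' v b) => [w|]; last first.
  split; rewrite /asked /= ?size_rcons ?lies_rcons ?depth_child //.
  - exact: valid_child.
  - exact: directed_child.
  - by lia.
  - apply: below_move_down v_below _ => //; first by lia.
    move=> eq_ij; have b_truth : b = truth n X v by apply/eqP; lia.
    by split=> //; apply: anc_None_below f'_dir _ => //; rewrite -b_truth.
  - by lia.
have [k [k_lt w_eq f'_w _ _]] := anc_Some _ _ _ _ f'_dir E.
rewrite size_rcons; case: ltnP => s1_lt; last first.
  split; rewrite /asked /= ?size_rcons ?lies_rcons //.
  - by lia.
  - by lia.
  - by apply: below_ancestor v_below; lia.
  (* The last query brings no move; it is paid for by the unit saved at the root, which [inv_moves]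
     releases once [n] queries have been asked. *)
  - by lia.
rewrite f'_w /ask_checkup /asked /= size_rcons; set c := ans _; case: eqP => [[c_eq]|c_neq].
  split; rewrite /asked /= ?size_rcons ?lies_rcons ?depth_child //.
  - exact: valid_child.
  - by lia.
  - exact: directed_child.
  - by lia.
  - apply: below_move_down v_below _ => //; first by lia.
    move=> eq_ij; have b_truth : b = truth n X v by apply/eqP; lia.
    have c_truth : c = truth n X w by apply/eqP; lia.
    (* A truthful checkup confirmed the answer stored at [w], so that answer is correct. *)
    split=> //; apply: (anc_Some_below n X f' v w) => //; first by rewrite -b_truth.
    by rewrite f'_w c_eq c_truth.
  - by lia.
have [] := below_move_up n X (lies n X s - u)
  (lies n X s + (b != truth n X v) + (c != truth n X w) - u) v v_valid d_lt _ v_below.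
- by lia.
(* If [v] were above [X], the answer stored at [w] would be correct and a truthful checkup would
   have confirmed it. *)
- move=> eq_ij; apply/negP => v_below0; have c_truth : c = truth n X w by apply/eqP; lia.
  apply: c_neq; rewrite -f'_w w_eq (stored_truth n X) ?(ltnW d_lt) //.
  by rewrite c_truth w_eq.
move=> lies_gt up_below.
split; rewrite /asked /= ?size_rcons ?lies_rcons //.
- exact: valid_parent.
- by lia.
- exact: directed_parent.
- by lia.
- by rewrite subnS.
- by lia.
Qed.

Lemma asked_iteration (n : nat) (ans : nat -> bool) (st : state) :
  asked st < n -> asked st < asked (iteration n ans st).
Proof.
rewrite /iteration => ->; rewrite /ask_main /=; case: anc => [w|].
  rewrite [asked (State _ _ _ _)]/asked size_rcons.
  case: ifP => _; last by rewrite /asked /= size_rcons.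
  by case: ifP => _; rewrite /asked /= !size_rcons.
by rewrite /asked /= size_rcons.
Qed.

Lemma search_inv_iter (n X t : nat) (ans : nat -> bool) :
  X < 2 ^ n -> search_inv n X (iter t (iteration n ans) initial_state).
Proof.
move=> X_lt; elim: t => [|t]; first exact: search_inv_initial.
exact: search_inv_iteration.
Qed.

Lemma asked_search (n X : nat) (ans : nat -> bool) : X < 2 ^ n -> asked (search n ans) = n.
Proof.
move=> X_lt; have inv t := search_inv_iter n X t ans X_lt.
apply/eqP; rewrite eqn_leq (inv_asked _ _ _ (inv n)) /=.
suff: forall t, t <= n -> t <= asked (iter t (iteration n ans) initial_state) by apply.
elim=> // t; rewrite iterS; set st := iter t _ _ => IHt t_lt.
have [a_lt|a_ge] := ltnP (asked st) n.
  by apply: leq_ltn_trans (IHt _) (asked_iteration _ _ _ a_lt); lia.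
by rewrite /iteration (ltnNge (asked st)) a_ge /=; apply: leq_trans a_ge.
Qed.

(** With d the final depth, [inv_moves] gives n <= 2d + 4 mu, and climbing costs at most H - mu
    levels; the depth bound follows from mu <= H. *)
Lemma reservation_node_spec (n H X : nat) (ans : nat -> bool) :
  X < 2 ^ n -> lies n X (log (search n ans)) <= H ->
  let a := ancestor (H - mu (search n ans)) (current (search n ans)) in
  [/\ below n X a, depth a <= n & n <= (depth a).*2 + 4 * H].
Proof.
move=> X_lt lies_le a.
have [v_valid d_le _ _ u_le v_below] := search_inv_iter n X n ans X_lt.
rewrite -/(search n ans) (asked_search n X ans X_lt) in d_le v_below u_le * => moves.
rewrite /a depth_ancestor; split.
- by apply: below_ancestor v_below; rewrite // leq_sub2r.
- by lia.
- by lia.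
Qed.

End Search.

(** * Best price and accepted price *)

Lemma best_price_mem (R : realType) (sigma : seq R) :
  (1 <= size sigma)%N -> best_price sigma \in sigma.
Proof.
case: sigma => // p s _; rewrite /best_price /=.
(* The default [p] of the maximum stays fixed while the list varies, which makes induction
   possible. *)
suff: forall t : seq R, \big[Num.max/p]_(q <- t) q \in p :: t.
  by move=> /(_ (p :: s)); rewrite !in_cons orbA orbb.
elim=> [|q t IHt]; first by rewrite big_nil mem_head.
rewrite big_cons /Num.max; case: ifP => _; last by rewrite !in_cons eqxx orbT.
by move: IHt; rewrite !in_cons => /orP[->//|->]; rewrite !orbT.
Qed.

Lemma first_at_least_ge (R : realType) (t : R) (sigma : seq R) (p : R) :
  p \in sigma -> t <= p -> t <= first_at_least t sigma.
Proof.
move=> p_in t_le; apply: (nth_find _ (a := fun q => t <= q)).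
by apply/hasP; exists p.
Qed.

(** * Interval end points and the leaf of the best price *)

Section Endpoints.
Variables (R : realType) (m M : R) (n : nat).
Hypotheses (m_gt0 : 0 < m) (m_lt_M : m < M).

Lemma ratio_gt1 : 1 < M / m.
Proof. by rewrite ltr_pdivlMr // mul1r. Qed.

Lemma rho_ge1 : 1 <= rho m M n.
Proof.
by rewrite -(powRr0 (M / m)) /rho ler_powR ?(ltW ratio_gt1).
Qed.

Lemma rho_exp (k : nat) : rho m M n ^+ k = (M / m) `^ (k%:R / 2 ^+ n).
Proof. by rewrite /rho -powR_mulrn ?powR_ge0 // -powRrM [_ / 2 ^+ n]mulrC. Qed.

Lemma endpoint_gt0 (i : nat) : 0 < endpoint m M n i.
Proof. by rewrite mulr_gt0 // exprn_gt0 // (lt_le_trans ltr01 rho_ge1). Qed.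

Lemma endpoint0 : endpoint m M n 0 = m.
Proof. by rewrite /endpoint expr0 mulr1. Qed.

Lemma endpoint_last : endpoint m M n (2 ^ n) = M.
Proof.
rewrite /endpoint rho_exp natrX divff ?expf_neq0 ?pnatr_eq0 //.
by rewrite powRr1 ?(ltW (lt_trans ltr01 ratio_gt1)) // mulrC divfK ?gt_eqF.
Qed.

Lemma endpoint_homo (i j : nat) : (i <= j)%N -> endpoint m M n i <= endpoint m M n j.
Proof. by move=> ij; rewrite ler_pM2l // ler_weXn2l ?rho_ge1. Qed.

Lemma endpointD (i k : nat) :
  endpoint m M n (i + k) = endpoint m M n i * (M / m) `^ (k%:R / 2 ^+ n).
Proof. by rewrite /endpoint exprD mulrA -rho_exp. Qed.

(** [X] is the least index with p <= a_(X+1), so p = m falls into the first leaf. Index 0 is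
    excluded because p = m also satisfies p <= a_0. *)
Lemma leaf_position (p : R) : p <= M ->
  exists2 X, (X < 2 ^ n)%N &
    forall i, (0 < i)%N -> (p <= endpoint m M n i) = (X < i)%N.
Proof.
move=> p_le; have exX : exists X, p <= endpoint m M n X.+1.
  by exists (2 ^ n).-1; rewrite prednK ?expn_gt0 // endpoint_last.
case: (ex_minnP exX) => X p_X X_min; exists X.
  by rewrite -(prednK (expn_gt0 2 n)) ltnS X_min // prednK ?expn_gt0 // endpoint_last.
case=> // i _; apply/idP/idP => [/X_min//|X_lt].
by apply: le_trans p_X _; apply: endpoint_homo.
Qed.

End Endpoints.

Theorem theorem6 (R : realType) (m M : R) (n H : nat)
    (m_gt0 : 0 < m) (m_lt_M : m < M) (n_ge1 : (1 <= n)%N)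
    (H_le : H%:R <= n%:R / 4 :> R)
    (sigma : seq R) (sigma_nonempty : (1 <= size sigma)%N)
    (sigma_range : forall p : R, p \in sigma -> m <= p <= M)
    (ans : nat -> bool)
    (incorrect_le : (num_incorrect m M n (best_price sigma) ans <= H)%N) :
  best_price sigma * (M / m) `^ (- 2 `^ (2 * H%:R - n%:R / 2))
    <= rbis_price m M n H ans sigma
  /\
  best_price sigma / rbis_price m M n H ans sigma
    <= (M / m) `^ (2 `^ (2 * H%:R - n%:R / 2)).
Proof.
set p := best_price sigma in incorrect_le *.
set e := 2 `^ (2 * H%:R - n%:R / 2).
set q := rbis_price m M n H ans sigma.
have p_in : p \in sigma by apply: best_price_mem.
have /andP[m_le p_le] := sigma_range p p_in.
have [X X_lt p_leaf] := leaf_position R m M n m_gt0 m_lt_M p p_le.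
have lies_le : (lies n X (log (search n ans)) <= H)%N.
  apply: leq_trans incorrect_le; rewrite /lies /num_incorrect.
  by rewrite (eq_count (a2 := fun qb : node * bool =>
    qb.2 != (p <= endpoint m M n (query_index n qb.1)))) // => qb; rewrite p_leaf.
have [] := reservation_node_spec n H X ans X_lt lies_le.
set a := ancestor _ _ => /andP[lo_le hi_gt] a_depth a_deep.
have q_def : q = first_at_least (endpoint m M n (span_lo n a)) sigma.
  by rewrite /q /rbis_price /reservation_index leaf_index_leftmost_leaf.
have lo_p : endpoint m M n (span_lo n a) <= p.
  (* At the left edge the bound is m itself, which p may equal; elsewhere it is strict. *)
  case: (span_lo n a) lo_le => [|i] i_le; first by rewrite endpoint0.
  by rewrite ltW // ltNge p_leaf // -leqNgt.
have lo_q : endpoint m M n (span_lo n a) <= q.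
  by rewrite q_def; apply: first_at_least_ge lo_p.
have q_gt0 : 0 < q by apply: lt_le_trans lo_q; apply: endpoint_gt0.
have r_gt1 := ratio_gt1 R m M m_gt0 m_lt_M.
have size_e : (2 ^ (n - depth a))%:R / 2 ^+ n <= e :> R.
  (* The leaf count of the subtree over 2^n is 2^(-depth); then n <= 2 depth + 4H compares the
     exponents. *)
  have -> : (2 ^ (n - depth a))%:R / 2 ^+ n = 2 `^ (- (depth a)%:R) :> R.
    rewrite powRN powR_mulrn // natrX -{2}(subnK a_depth) exprD invfM mulrA.
    by rewrite divff ?mul1r // expf_neq0 ?pnatr_eq0.
  rewrite /e ler_powR ?ler1n //.
  by move: a_deep; rewrite -(ler_nat R) natrD -mul2n !natrM; lra.
have p_q : p <= q * (M / m) `^ e.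
  (* The upper end of the interval of [a] is its lower end, at most [q], times the price ratio
     across the subtree. *)
  have : p <= endpoint m M n (span_hi n a) by rewrite p_leaf // (leq_ltn_trans _ hi_gt).
  rewrite /span_hi mulSn addnC endpointD => /le_trans; apply.
  apply: ler_pM => //; first exact/ltW/endpoint_gt0.
    exact: powR_ge0.
  by rewrite ler_powR // ltW.
split; last by rewrite ler_pdivrMr // mulrC.
by rewrite powRN ler_pdivrMr // powR_gt0 // (lt_trans ltr01 r_gt1).
Qed.
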